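(* Assume $c=1$, i.e. $a^{ij}b_ib_j=-1$. For $y\in T_xM$ in the future-time-like sector ($\epsilon=1$) or in the space-like sector ($\epsilon=-1$) let $\hat y=\{y_i\}$, $y_i=\frac12\frac{\partial F^2}{\partial y^i}(x,y)$, and put $$\hat b=y_ib^i,\qquad \hat q=\sqrt{|y_iy_j(a^{ij}+b^ib^j)|},\qquad \hat B=\epsilon\hat q^2+g\,\hat b\,\hat q-\hat b^2 .$$ Then $\hat b=(b+gq)J^2$, $\hat q=qJ^2$, $\hat B=BJ^4$, and the squared Hamiltonian function $H^2(x,\hat y)$, determined by the equality $H^2(x,\hat y)=F^2(x,y)$, is given explicitly as follows. In the future-time-like sector ($\epsilon=1$): $$H^2(x,\hat y)=\hat B(x,\hat y)\,\hat J^2(x,\hat y)\equiv(\hat b+g_+\hat q)^{-G_-}(-g_-\hat q-\hat b)^{G_+},$$ $$\hat J(x,\hat y)=\left(\frac{\hat b+g_+\hat q}{-g_-\hat q-\hat b}\right)^{G/4}\equiv\frac1{J(x,y)},\qquad \hat B=(\hat b+g_+\hat q)(-g_-\hat q-\hat b),$$ with $G_\pm=g_\pm/h$. In the space-like sector ($\epsilon=-1$): $$H^2(x,\hat y)=\hat B(x,\hat y)\,\hat J^2(x,\hat y),\qquad \hat J(x,\hat y)=e^{\frac12G\hat f(x,\hat y)}\equiv\frac1{J(x,y)},$$ with $$\hat f=\arctan\frac G2+\arctan\frac{\hat L}{h\hat b}\ \text{ if }\hat b\ge0,\qquad \hat f=\pi+\arctan\frac G2+\arctan\frac{\hat L}{h\hat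 b}\ \text{ if }\hat b\le0,$$ where $\hat L=\hat q-\frac g2\hat b$.
   Context: Let $M$ be an $N$-dimensional smooth manifold with a pseudo-Riemannian metric tensor $a_{ij}(x)$ of signature $(+,-,\dots,-)$ and inverse $a^{ij}$, a 1-form $b_i(x)$ with $a^{ij}b_ib_j=-1$, and a scalar field $g(x)$. Put $b^i=a^{ij}b_j$. For $y\in T_xM$ put $$b=b_i(x)y^i,\quad r_{ij}=a_{ij}+b_ib_j,\quad \gamma=r_{ij}y^iy^j,\quad q=\sqrt{|\gamma|},\quad B=\gamma-g\,b\,q-b^2 .$$ In both sectors below $G=g/h$ and $g_\pm=-\frac12g\pm h$, with $h$ as specified for the sector. Future-time-like sector ($\epsilon=1$, $-\infty<g<\infty$, $h=\sqrt{1+g^2/4}$): the future-directed $y\in T_xM$ with $\gamma>0$ such that either $b\ge0$ and $q>-g_-b$, or $b\le0$ and $q>-g_+b$. There $B=q^2-gbq-b^2=(b-g_-q)(g_+q-b)>0$ and $J=\left(\frac{b-g_-q}{g_+q-b}\right)^{-G/4}$. Space-like sector ($\epsilon=-1$, $-2<g<2$, $h=\sqrt{1-g^2/4}$): the $y\in T_xM$ with $\gamma<0$ such that either $b\ge0$ and $q<-g_-b$, or $b\le0$ and $q<-g_+b$. There $B=-(q^2+gbq+b^2)<0$ and $J=e^{-\frac12Gf}$, where, with $L=q+\frac g2b$, $f=-\arctan\frac G2+\arctan\frac{L}{hb}$ if $b\le0$ and $f=-\pi-\arctan\frac G2+\arctan\frac{L}{hb}$ if $b\ge0$. In both sectors the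 squared metric function is $F^2(x,y)=B(x,y)J^2(x,y)$.
   Formalization: In the space-like sector the printed $\hat f$ equals $f+\pi$, so $\hat J=1/J$ and $H^2=\hat B\hat J^2$ fail whenever $g\ne0$; the formal statement subtracts $\pi$ from both branches of $\hat f$, which gives $\hat f=f$. *)

(* Defs.v *)
From mathcomp Require Import all_boot all_order all_algebra.
From mathcomp Require Import all_classical all_reals all_analysis.
Set Implicit Arguments.
Unset Strict Implicit.
Unset Printing Implicit Defensive.
Import Order.TTheory GRing.Theory Num.Theory.
Import numFieldNormedType.Exports.
Local Open Scope ring_scope.

Inductive sector := FutureTimeLike | SpaceLike.

(* All statements are fibrewise.  M is the set of points of the manifold; at
   each x : M, tangent vectors and covectors are given by their components
   (row vectors) with respect to local coordinates around x and the dual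
   coframe.  The derivatives below are taken along the fibre only. *)
Section PseudoFinsleroid.

Variables (R : realType) (N : nat) (M : Type).

(* Signature (+,-,...,-): some frame is orthonormal, its zeroth vector having
   square +1 and the others -1.  This entails that A is symmetric and
   invertible. *)
Definition lorentzian (A : 'M[R]_N) : Prop :=
  exists2 P : 'M[R]_N, P \in unitmx &
    P *m A *m P^T = diag_mx (\row_(i < N) (if i == 0%N :> nat then 1 else -1)).

Variables (a : M -> 'M[R]_N) (b_ : M -> 'rV[R]_N) (g : M -> R).
Implicit Types (x : M) (y t p : 'rV[R]_N) (s : sector).

Definition ainv x : 'M[R]_N := invmx (a x).

Definition bup x : 'rV[R]_N := \row_i \sum_j ainv x i j * b_ x 0 j.

Definition b_normsq x : R := \sum_i \sum_j ainv x i j * b_ x 0 i * b_ x 0 j.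

Definition metric_form x y t : R := \sum_i \sum_j a x i j * y 0 i * t 0 j.

Definition r_ x (i j : 'I_N) : R := a x i j + b_ x 0 i * b_ x 0 j.

Definition bf x y : R := \sum_i b_ x 0 i * y 0 i.
Definition gam x y : R := \sum_i \sum_j r_ x i j * y 0 i * y 0 j.
Definition qf x y : R := Num.sqrt `|gam x y|.
Definition Bf x y : R := gam x y - g x * bf x y * qf x y - bf x y ^+ 2.

Definition eps s : R := if s is FutureTimeLike then 1 else -1.

Definition admissible s (c : R) : Prop :=
  if s is SpaceLike then -2 < c < 2 else True.

Definition hf s x : R :=
  match s with
  | FutureTimeLike => Num.sqrt (1 + g x ^+ 2 / 4)
  | SpaceLike => Num.sqrt (1 - g x ^+ 2 / 4)
  end.
Definition Gf s x : R := g x / hf s x.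
Definition gplus s x : R := - (g x / 2) + hf s x.
Definition gminus s x : R := - (g x / 2) - hf s x.
Definition Gplus s x : R := gplus s x / hf s x.
Definition Gminus s x : R := gminus s x / hf s x.

(* The time orientation is given by a time-like vector field t.  Vectors with
   gam > 0 need not be time-like for the metric a, so "future-directed" has to
   mean: in the component of the cone {gam > 0} that contains t.  That cone has
   two components (r_ is degenerate along bup, of signature (+,-,...,-) modulo
   bup), told apart by the sign of r_ij t^i y^j; for y time-like this is also
   the sign of a_ij t^i y^j. *)
Definition future_directed (tt : M -> 'rV[R]_N) x y : Prop :=
  0 < \sum_i \sum_j r_ x i j * tt x 0 i * y 0 j.

Definition in_sector (tt : M -> 'rV[R]_N) s x y : Prop :=
  match s with
  | FutureTimeLike =>
      [/\ future_directed tt x y, 0 < gam x y &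
          (0 <= bf x y /\ qf x y > - gminus s x * bf x y) \/
          (bf x y <= 0 /\ qf x y > - gplus s x * bf x y)]
  | SpaceLike =>
      gam x y < 0 /\
      ((0 <= bf x y /\ qf x y < - gminus s x * bf x y) \/
       (bf x y <= 0 /\ qf x y < - gplus s x * bf x y))
  end.

(* The value at bf x y = 0 is irrelevant: the space-like sector contains no
   such y, since there q < 0 would be required. *)
Definition ff s x y : R :=
  let L := qf x y + g x / 2 * bf x y in
  if bf x y <= 0 then
    - atan (Gf s x / 2) + atan (L / (hf s x * bf x y))
  else
    - pi - atan (Gf s x / 2) + atan (L / (hf s x * bf x y)).

Definition Jf s x y : R :=
  match s with
  | FutureTimeLike =>
      ((bf x y - gminus s x * qf x y) / (gplus s x * qf x y - bf x y))
        `^ (- (Gf s x / 4))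
  | SpaceLike => expR (- (2^-1 * Gf s x * ff s x y))
  end.

Definition F2 s x y : R := Bf x y * Jf s x y ^+ 2.

Definition yhat s x y : 'rV[R]_N :=
  \row_i (2^-1 * 'D_(delta_mx 0 i) (F2 s x) y).

Definition bhat x p : R := \sum_i p 0 i * bup x 0 i.

Definition qhat x p : R :=
  Num.sqrt `|\sum_i \sum_j
    p 0 i * p 0 j * (ainv x i j + bup x 0 i * bup x 0 j)|.

Definition Bhat s x p : R :=
  eps s * qhat x p ^+ 2 + g x * bhat x p * qhat x p - bhat x p ^+ 2.

(* The final "- pi" normalizes fhat consistently with ff, whose branches are
   normalized by ff = 0 on the half-axis q = 0, b < 0: with it
   fhat x (yhat s x y) = ff s x y.  The conditional alone equals ff + pi, which
   would give Jhat * J = exp (pi * G / 2) instead of Jhat = 1 / J. *)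
Definition fhat s x p : R :=
  let Lhat := qhat x p - g x / 2 * bhat x p in
  (if 0 <= bhat x p then
     atan (Gf s x / 2) + atan (Lhat / (hf s x * bhat x p))
   else
     pi + atan (Gf s x / 2) + atan (Lhat / (hf s x * bhat x p))) - pi.

Definition Jhat s x p : R :=
  match s with
  | FutureTimeLike =>
      ((bhat x p + gplus s x * qhat x p) / (- gminus s x * qhat x p - bhat x p))
        `^ (Gf s x / 4)
  | SpaceLike => expR (2^-1 * Gf s x * fhat s x p)
  end.

(* H2 is a squared Hamiltonian function of the sector: the defining equality
   determines it on the covectors yhat, and only there. *)
Definition squared_hamiltonian (tt : M -> 'rV[R]_N) s
    (H2 : M -> 'rV[R]_N -> R) : Prop :=
  forall x y, in_sector tt s x y -> H2 x (yhat s x y) = F2 s x y.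

End PseudoFinsleroid.

(* Main.v *)
Require Import Defs.
From mathcomp Require Import all_boot all_order all_algebra.
From mathcomp Require Import all_classical all_reals all_analysis.
From mathcomp Require Import ring lra.
Set Implicit Arguments.
Unset Strict Implicit.
Unset Printing Implicit Defensive.
Import Order.TTheory GRing.Theory Num.Theory.
Import numFieldNormedType.Exports.
Local Open Scope ring_scope.

(* Everything reduces to two functions on the fibre, b and q, through
     y_i = J^2 (r_ij y^j - (b + g q) b_i),
   which comes from 2 q dq = eps d(gamma) and the cancellation of all other terms in
   d(B J^2).  Since b^i b_i = -1, b^i spans the kernel of r_ij and b_i that of
   a^ij + b^i b^j, which gives bhat and qhat, hence Bhat.  For time-like y the two factors
   of B are each multiplied by J^2, so the quotient defining Jhat is the one defining J.
   For space-like y the arguments of the two arctangents are related by a rotation by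
   2 arctan (G/2); that no branch jump occurs amounts to (b + g q) / b > 0, which the
   inequalities defining the sector guarantee. *)

(** * Derivative of $B J^2$ along a line, as a function of one real variable *)

Lemma is_derive_timelike (R : realType) (b q : R -> R) (g h b' q' : R) :
  let gp := - (g / 2) + h in let gm := - (g / 2) - h in
  let u t := b t - gm * q t in let v t := gp * q t - b t in
  let J t := (u t / v t) `^ (- (g / h / 4)) in
  h != 0 -> h ^+ 2 = 1 + g ^+ 2 / 4 -> 0 < u 0 -> 0 < v 0 ->
  is_derive (0 : R) (1 : R) b b' -> is_derive (0 : R) (1 : R) q q' ->
  is_derive (0 : R) (1 : R)
    (fun t => (q t ^+ 2 - g * b t * q t - b t ^+ 2) * J t ^+ 2)
    (2 * ((q 0 * q' - (b 0 + g * q 0) * b') * J 0 ^+ 2)).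
Proof.
move=> gp gm u v J h0 hE u0 v0 db dq.
have du : is_derive (0 : R) (1 : R) u (b' - gm * q').
  exact: (is_deriveB db (is_deriveZ gm dq)).
have dv : is_derive (0 : R) (1 : R) v (gp * q' - b').
  exact: (is_deriveB (is_deriveZ gp dq) db).
have dw : is_derive (0 : R) (1 : R) (fun t => u t / v t)
    (((b' - gm * q') * v 0 - u 0 * (gp * q' - b')) / v 0 ^+ 2).
  have dvi := @is_deriveV _ _ _ _ _ (lt0r_neq0 v0) dv.
  apply: is_derive_eq (is_deriveM du dvi) _.
  by rewrite /GRing.scale /=; field; rewrite lt0r_neq0.
have w0 : 0 < u 0 / v 0 by rewrite divr_gt0.
have dJ : is_derive (0 : R) (1 : R) J _ :=
  @is_derive1_comp _ (@powR R ^~ (- (g / h / 4))) (fun t => u t / v t) _ _ _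
    (is_derive1_powR (- (g / h / 4)) w0) dw.
have dJ2 := is_deriveX 2 dJ.
have dB : is_derive (0 : R) (1 : R)
    (fun t => q t ^+ 2 - g * b t * q t - b t ^+ 2)
    (2 * q 0 * q' - g * (b 0 * q' + q 0 * b') - 2 * b 0 * b').
  have dbq := is_deriveZ g (is_deriveM db dq).
  have := is_deriveB (is_deriveB (is_deriveX 2 dq) dbq) (is_deriveX 2 db).
  rewrite /GRing.scale /= => d.
  rewrite (_ : (fun t => _) = q ^+ 2 - (fun x => g * (b * q) x) - b ^+ 2); last first.
    by apply/funext => t; rewrite !fctE mulrA.
  by apply: is_derive_eq d _; rewrite !expr1.
have d := is_deriveM dB dJ2.
apply: (is_derive_eq d) => /=.
(* Splitting the exponent $r - 1$ turns the derived power into [J 0] divided by $u/v$. From here on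
   [J 0] is an opaque factor and the goal is a rational identity. *)
rewrite /GRing.scale /= powRB; last by rewrite lt0r_neq0 ?implybT.
rewrite powRr1 ?ltW// !fctE /= -/(J 0) expr1.
have -> : q 0 ^+ 2 - g * b 0 * q 0 - b 0 ^+ 2 = u 0 * v 0.
  rewrite /u /v /gp /gm; transitivity ((h ^+ 2 - g ^+ 2 / 4) * q 0 ^+ 2 - g * b 0 * q 0 - b 0 ^+ 2).
    by rewrite hE; field.
  by field.
(* Here $2h$ is [gp - gm]; it cancels the $h$ in the exponent. The power thus contributes $-g(b'q -
   q'b)J^2$, whose $q'$ term cancels the $-g b q'$ coming from $dB$. *)
have -> : (b' - gm * q') * v 0 - u 0 * (gp * q' - b') = 2 * h * (b' * q 0 - q' * b 0).
  by rewrite /u /v /gp /gm; field.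
have un0 := lt0r_neq0 u0; have vn0 := lt0r_neq0 v0.
by generalize (J 0) (u 0) (v 0) un0 vn0 => j u1 v1 u1n v1n; field; rewrite h0 u1n v1n.
Qed.

(** The constant [c] stands for the part of [ff] that is locally constant, so both branches are
    covered at once. The arctangent contributes $g(bq' - qb')J^2$, which again removes the $b q'$
    term of $dB$. *)
Lemma is_derive_spacelike (R : realType) (b q : R -> R) (g h c b' q' : R) :
  let f t := c + atan ((q t + g / 2 * b t) / (h * b t)) in
  let J t := expR (- (2^-1 * (g / h) * f t)) in
  h != 0 -> h ^+ 2 = 1 - g ^+ 2 / 4 -> b 0 != 0 ->
  is_derive (0 : R) (1 : R) b b' -> is_derive (0 : R) (1 : R) q q' ->
  is_derive (0 : R) (1 : R)
    (fun t => (- q t ^+ 2 - g * b t * q t - b t ^+ 2) * J t ^+ 2)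
    (2 * ((- (q 0 * q') - (b 0 + g * q 0) * b') * J 0 ^+ 2)).
Proof.
move=> f J h0 hE b0 db dq.
have dL : is_derive (0 : R) (1 : R) (fun t => q t + g / 2 * b t) (q' + g / 2 * b').
  exact: (is_deriveD dq (is_deriveZ (g / 2) db)).
have dhb : is_derive (0 : R) (1 : R) (fun t => h * b t) (h * b').
  exact: (is_deriveZ h db).
have hb0 : h * b 0 != 0 by rewrite mulf_neq0.
have dw : is_derive (0 : R) (1 : R) (fun t => (q t + g / 2 * b t) / (h * b t))
    ((b 0 * q' - q 0 * b') / (h * b 0 ^+ 2)).
  have dvi := @is_deriveV _ (fun t => h * b t) _ _ _ hb0 dhb.
  apply: is_derive_eq (is_deriveM dL dvi) _.
  by rewrite /GRing.scale /=; field; rewrite h0 b0.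
have df : is_derive (0 : R) (1 : R) f _ :=
  
  is_deriveD (is_derive_cst c (0 : R) (1 : R))
    (@is_derive1_comp _ atan (fun t => (q t + g / 2 * b t) / (h * b t)) _ _ _
      (is_derive1_atan _) dw).
have de : is_derive (0 : R) (1 : R) (fun t => - (2^-1 * (g / h) * f t)) _ :=
  is_deriveN (is_deriveZ (2^-1 * (g / h)) df).
have dJ : is_derive (0 : R) (1 : R) J _ :=
  @is_derive1_comp _ expR (fun t => - (2^-1 * (g / h) * f t)) _ _ _
    (is_derive_expR _) de.
have dJ2 := is_deriveX 2 dJ.
have dB : is_derive (0 : R) (1 : R)
    (fun t => - q t ^+ 2 - g * b t * q t - b t ^+ 2)
    (- (2 * q 0 * q') - g * (b 0 * q' + q 0 * b') - 2 * b 0 * b').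
  have dbq := is_deriveZ g (is_deriveM db dq).
  have := is_deriveB (is_deriveB (is_deriveN (is_deriveX 2 dq)) dbq) (is_deriveX 2 db).
  rewrite /GRing.scale /= => d.
  rewrite (_ : (fun t => _) = - (q ^+ 2) - (fun x => g * (b * q) x) - b ^+ 2); last first.
    by apply/funext => t; rewrite !fctE mulrA.
  by apply: is_derive_eq d _; rewrite !expr1.
have d := is_deriveM dB dJ2.
apply: (is_derive_eq d) => /=.
rewrite /GRing.scale /= !fctE /= -/(f 0) -/(J 0) expr1 add0r.
set w := (_ + _ / 2 * _) / _.
(* Completing the square, $-B = L^2 + h^2b^2$, exhibits the factor $1 + w^2$ that cancels the
   denominator of the derivative of [atan]. *)
have B0 : q 0 ^+ 2 + g * b 0 * q 0 + b 0 ^+ 2 = (1 + w ^+ 2) * (h * b 0) ^+ 2.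
  rewrite mulrDl -exprMn divfK// mul1r exprMn hE.
  by field.
have -> : - q 0 ^+ 2 - g * b 0 * q 0 - b 0 ^+ 2 = - ((1 + w ^+ 2) * (h * b 0) ^+ 2).
  by rewrite -B0; ring.
have w1 : 1 + w ^+ 2 != 0 by rewrite lt0r_neq0// ltr_pwDl// sqr_ge0.
clearbody w; field.
by rewrite h0 b0 w1.
Qed.

(** * Linear algebra of $a_{ij}$, $r_{ij}$ and $a^{ij} + b^ib^j$ *)

Lemma lorentzian_sym (R : realType) n (A : 'M[R]_n) : lorentzian A -> A^T = A.
Proof.
case=> P Pu E; have := congr1 trmx E.
rewrite tr_diag_mx -E !trmx_mul trmxK mulmxA.
have PTu : P^T \in unitmx by rewrite unitmx_tr.
by move/(can_inj (mulmxK PTu)); move/(can_inj (mulKmx Pu)).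
Qed.

Lemma lorentzian_unit (R : realType) n (A : 'M[R]_n) : lorentzian A -> A \in unitmx.
Proof.
case=> P Pu E; rewrite unitmxE unitfE.
have : \det (P *m A *m P^T) != 0.
  rewrite E det_diag prodf_seq_neq0; apply/allP => i _ /=.
  by rewrite mxE; case: ifP => _; rewrite ?oppr_eq0 oner_eq0.
by rewrite !det_mulmx !mulf_eq0 !negb_or => /andP[/andP[]].
Qed.

Lemma sum_bilinearE (R : realType) n (A : 'M[R]_n) (y z : 'rV[R]_n) :
  \sum_i \sum_j A i j * y 0 i * z 0 j = (y *m A *m z^T) 0 0.
Proof.
rewrite mxE exchange_big; apply: eq_bigr => j _ /=.
rewrite !mxE mulr_suml; apply: eq_bigr => i _.
by rewrite [A i j * _]mulrC.
Qed.

Section FormR.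
Variables (R : realType) (N : nat) (M : Type).
Variables (a : M -> 'M[R]_N) (b : M -> 'rV[R]_N).
Variable (x : M).
Hypothesis ha : lorentzian (a x).
Hypothesis hb : b_normsq a b x = -1.
Implicit Types y v p : 'rV[R]_N.

Definition rmx : 'M[R]_N := a x + (b x)^T *m b x.

Definition rform y v : R := (y *m rmx *m v^T) 0 0.

Lemma rmxE i j : rmx i j = r_ a b x i j.
Proof. by rewrite /rmx /r_ !mxE big_ord1 !mxE. Qed.

Lemma bfE y : bf b x y = (y *m (b x)^T) 0 0.
Proof. by rewrite /bf mxE; apply: eq_bigr => i _; rewrite !mxE mulrC. Qed.

Lemma gamE y : gam a b x y = rform y y.
Proof.
rewrite /rform -sum_bilinearE; apply: eq_bigr => i _; apply: eq_bigr => j _.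
by rewrite rmxE.
Qed.

Lemma bupE : bup a b x = b x *m invmx (a x).
Proof.
apply/rowP => i; rewrite !mxE; apply: eq_bigr => j _.
rewrite mulrC; congr (_ * _).
by rewrite /ainv -[in LHS](lorentzian_sym ha) -trmx_inv mxE.
Qed.

Lemma mul_b_bup : b x *m (bup a b x)^T = (-1)%:M.
Proof.
have := hb; rewrite /b_normsq sum_bilinearE -bupE => E.
apply/matrixP => i j; rewrite !ord1 !mxE eqxx mulr1n -E mxE.
by apply: eq_bigr => k _; rewrite !mxE mulrC.
Qed.

Lemma rmx_sym : rmx^T = rmx.
Proof. by rewrite /rmx linearD /= trmx_mul trmxK (lorentzian_sym ha). Qed.

Lemma rmx_bup : rmx *m (bup a b x)^T = 0.
Proof.
rewrite /rmx mulmxDl -mulmxA mul_b_bup bupE trmx_mul trmx_inv (lorentzian_sym ha).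
by rewrite mulKVmx ?(lorentzian_unit ha)// mul_mx_scalar scaleN1r subrr.
Qed.

(** Not a true inverse of [rmx], both being degenerate: on row vectors their product is the
    projection along [bup] onto the kernel of $b$. *)
Definition rinv : 'M[R]_N := ainv a x + (bup a b x)^T *m bup a b x.

Lemma qhatE p : qhat a b x p = Num.sqrt `|(p *m rinv *m p^T) 0 0|.
Proof.
rewrite /qhat -sum_bilinearE; congr (Num.sqrt `|_|).
apply: eq_bigr => i _; apply: eq_bigr => j _.
by rewrite /rinv !mxE big_ord1 !mxE mulrC mulrA.
Qed.

Lemma bhatE p : bhat a b x p = (p *m (bup a b x)^T) 0 0.
Proof. by rewrite /bhat mxE; apply: eq_bigr => i _; rewrite !mxE. Qed.

Lemma mul_b_rinv : b x *m rinv = 0.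
Proof.
by rewrite /rinv mulmxDr -bupE mulmxA mul_b_bup mul_scalar_mx scaleN1r subrr.
Qed.

Lemma mul_rmx_rinv : rmx *m rinv = 1%:M + (b x)^T *m bup a b x.
Proof.
rewrite /rinv mulmxDr mulmxA rmx_bup mul0mx addr0 /rmx mulmxDl -mulmxA -bupE.
by rewrite mulmxV ?(lorentzian_unit ha).
Qed.

Section CovectorNorms.
Variables (y : 'rV[R]_N) (c e : R).
Let p := c *: (e *: b x + y *m rmx).

(** The scalars [c] and [e] anticipate $J^2$ and $-(b + gq)$, their values for [yhat]. *)
Lemma bhat_covector : bhat a b x p = - (c * e).
Proof.
rewrite bhatE /p -scalemxAl mulmxDl -scalemxAl mul_b_bup -mulmxA rmx_bup mulmx0 addr0.
by rewrite !mxE eqxx mulr1n mulrN1 mulrN.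
Qed.

(** Raising the index of [p] with [rinv] kills the $b$ component and leaves [c] times the projection
    of [y] to the kernel of $b$. Pairing that with [p] removes [e] once more, so only $c^2\gamma(y)$
    survives. *)
Lemma qhat_covector : qhat a b x p = qf a b x y * `|c|.
Proof.
rewrite qhatE /qf /p.
have -> : c *: (e *: b x + y *m rmx) *m rinv = c *: (y + (y *m (b x)^T) *m bup a b x).
  by rewrite -scalemxAl mulmxDl -scalemxAl mul_b_rinv scaler0 add0r -mulmxA mul_rmx_rinv
    mulmxDr mulmx1 mulmxA.
rewrite linearZ /= -scalemxAl -scalemxAr scalerA -expr2.
have bT : bup a b x *m (b x)^T = (-1)%:M.
  by rewrite -[LHS]trmxK trmx_mul trmxK mul_b_bup tr_scalar_mx.
have bR : bup a b x *m rmx = 0.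
  by rewrite -[LHS]trmxK trmx_mul rmx_sym rmx_bup trmx0.
rewrite linearD linearZ /= trmx_mul rmx_sym.
have -> : (y + y *m (b x)^T *m bup a b x) *m (e *: (b x)^T + rmx *m y^T) =
   y *m rmx *m y^T.
  rewrite mulmxDl mulmxDr -[_ *m bup _ _ _ *m _]mulmxA [bup _ _ _ *m _]mulmxDr.
  rewrite [bup a b x *m (rmx *m _)]mulmxA bR mul0mx addr0 -!scalemxAr bT.
  by rewrite mul_mx_scalar scaleN1r scalerN addrAC subrr add0r mulmxA.
rewrite mxE gamE -/(rform y y) normrM sqrtrM ?normr_ge0// mulrC.
by rewrite (ger0_norm (sqr_ge0 c)) sqrtr_sqr.
Qed.

End CovectorNorms.

Lemma is_derive_bf y v :
  is_derive (0 : R) (1 : R) (fun t => bf b x (t *: v + y)) (bf b x v).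
Proof.
have -> : (fun t => bf b x (t *: v + y)) = (fun t => bf b x v * t + bf b x y).
  by apply/funext => t; rewrite !bfE mulmxDl -scalemxAl !mxE mulrC.
apply: is_derive_eq (is_deriveD (is_deriveZ (bf b x v) (is_derive_id (0 : R) (1 : R)))
  (is_derive_cst (bf b x y) (0 : R) (1 : R))) _.
by rewrite addr0 /GRing.scale /= mulr1.
Qed.

Lemma rform_sym y v : rform y v = rform v y.
Proof.
rewrite /rform -[in LHS](trmxK (y *m rmx *m v^T)) [LHS]mxE.
by rewrite !trmx_mul trmxK rmx_sym mulmxA.
Qed.

Lemma is_derive_gam y v :
  is_derive (0 : R) (1 : R) (fun t => gam a b x (t *: v + y)) (2 * rform y v).
Proof.
have -> : (fun t => gam a b x (t *: v + y)) =
    (fun t => rform v v * (t * t) + 2 * rform y v * t + rform y y).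
  apply/funext => t; rewrite gamE; have := rform_sym v y; rewrite /rform.
  move: (rmx) => r rE.
  have -> : (t *: v + y)^T = t *: v^T + y^T by rewrite linearD linearZ.
  rewrite !mulmxDl !mulmxDr -!scalemxAl -!scalemxAr.
  by move: rE; rewrite !mxE => ->; ring.
have did := is_derive_id (0 : R) (1 : R).
apply: is_derive_eq (is_deriveD (is_deriveD
  (is_deriveZ (rform v v) (is_deriveM did did)) (is_deriveZ (2 * rform y v) did))
  (is_derive_cst (rform y y) (0 : R) (1 : R))) _.
by rewrite addr0 /GRing.scale /= !mul0r addr0 mulr0 add0r mulr1.
Qed.

End FormR.

(** * Differentiating the square root of an absolute value *)

Lemma near0_is_derive (R : realType) (f : R -> R) d :
  is_derive (0 : R) (1 : R) f d -> 0 < f 0 -> \forall t \near (0 : R), 0 < f t.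
Proof.
move=> df f0.
have /derivable1_diffP/differentiable_continuous cf : derivable f 0 1 by exact: ex_derive.
by move: cf => /(cvgr_gt (f 0)); apply.
Qed.

Lemma norm_sign (R : realType) (e r : R) : `|e| = 1 -> 0 < e * r -> `|r| = e * r.
Proof. by move=> e1 er; rewrite -(gtr0_norm er) normrM e1 mul1r. Qed.

(** By continuity [f] keeps its sign [e] near 0, where the absolute value is therefore the smooth
    function [e * f]. *)
Lemma is_derive_sqrt_norm (R : realType) (f : R -> R) e d :
  `|e| = 1 -> is_derive (0 : R) (1 : R) f d -> 0 < e * f 0 ->
  is_derive (0 : R) (1 : R) (fun t => Num.sqrt `|f t|) (e * d / (2 * Num.sqrt `|f 0|)).
Proof.
move=> e1 df f0; have def := is_deriveZ e df.
have := near0_is_derive def f0; rewrite /GRing.scale /= => nef.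
rewrite (norm_sign e1 f0).
have d1 := @is_derive1_comp _ (@Num.sqrt R) (fun t => e * f t) _ _ _
    (is_derive1_sqrt f0) def.
apply: near_eq_is_derive (is_derive_eq d1 _); last by rewrite mulrC.
by near=> t; rewrite /= (norm_sign e1)//; near: t.
Unshelve. all: by end_near. Qed.

(** * Sector inequalities and the fibre derivative of $F^2$ *)

Section FibreDerivative.
Variables (R : realType) (N : nat) (M : Type).
Variables (a : M -> 'M[R]_N) (b : M -> 'rV[R]_N) (g : M -> R) (tt : M -> 'rV[R]_N).
Variable (x : M).
Hypothesis ha : lorentzian (a x).
Implicit Types (y v : 'rV[R]_N) (s : sector).

Lemma hf_gt0 s : admissible s (g x) -> 0 < hf g s x.
Proof.
case: s => /=; first by rewrite sqrtr_gt0 ltr_pwDl// divr_ge0 ?sqr_ge0.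
by move=> /andP[g1 g2]; rewrite sqrtr_gt0; nra.
Qed.

Lemma hf_sqr s : admissible s (g x) -> hf g s x ^+ 2 = 1 + eps R s * (g x ^+ 2 / 4).
Proof.
case: s => /=; first by rewrite sqr_sqrtr ?mul1r// addr_ge0// divr_ge0 ?sqr_ge0.
by move=> /andP[g1 g2]; rewrite sqr_sqrtr ?mulN1r//; nra.
Qed.

Lemma norm_eps s : `|eps R s| = 1.
Proof. by case: s => /=; rewrite ?normrN normr1. Qed.

Lemma gplus_gt0 : 0 < gplus g FutureTimeLike x.
Proof.
have := @hf_gt0 FutureTimeLike I; have := @hf_sqr FutureTimeLike I.
by rewrite /= /gplus /=; nra.
Qed.

Lemma gminus_lt0 : gminus g FutureTimeLike x < 0.
Proof.
have := @hf_gt0 FutureTimeLike I; have := @hf_sqr FutureTimeLike I.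
by rewrite /= /gminus /=; nra.
Qed.

Lemma gplus_gminus : gplus g FutureTimeLike x * gminus g FutureTimeLike x = -1.
Proof.
have := @hf_sqr FutureTimeLike I; rewrite /gplus /gminus.
by move: (hf _ _ _) => h /=; lra.
Qed.

Lemma sector_gam s y : in_sector a b g tt s x y -> 0 < eps R s * gam a b x y.
Proof. by case: s => -[] /=; rewrite ?mul1r// mulN1r oppr_gt0. Qed.

Lemma sector_qf_gt0 s y : in_sector a b g tt s x y -> 0 < qf a b x y.
Proof.
move/sector_gam => e0; rewrite sqrtr_gt0 normr_gt0.
by apply: contraTneq e0 => ->; rewrite mulr0 ltxx.
Qed.

Lemma qf_sqr s y : 0 < eps R s * gam a b x y ->
  gam a b x y = eps R s * qf a b x y ^+ 2.
Proof.
move=> e0; rewrite /qf sqr_sqrtr// (norm_sign (norm_eps s) e0) mulrA -expr2.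
by case: s {e0}; rewrite /= ?sqrrN expr1n mul1r.
Qed.

(** In each case one factor is positive by the sign of $b$ alone. The other is the sector inequality
    multiplied by $g_+$ or by $-g_-$, using $g_+g_- = -1$. *)
Lemma timelike_factors y : in_sector a b g tt FutureTimeLike x y ->
  0 < bf b x y - gminus g FutureTimeLike x * qf a b x y /\
  0 < gplus g FutureTimeLike x * qf a b x y - bf b x y.
Proof.
move=> yS; have q0 := sector_qf_gt0 yS.
have gp0 := gplus_gt0; have gm0 := gminus_lt0; have gpm := gplus_gminus.
case: yS => _ _; move: (gplus _ _ _) (gminus _ _ _) (bf _ _ _) (qf _ _ _ _) gp0 gm0 gpm q0.
by move=> gp gm c q gp0 gm0 gpm q0 [[c0 qc]|[c0 qc]]; split; nra.
Qed.

Lemma spacelike_bf_neq0 y : in_sector a b g tt SpaceLike x y -> bf b x y != 0.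
Proof.
move=> yS; have q0 := sector_qf_gt0 yS; apply/eqP => b0.
by case: yS => _; rewrite b0 !mulr0 => -[] [] _ /(lt_trans q0); rewrite ltxx.
Qed.

(* [bhat = (b + g q) J^2] has the sign of [b], so [y] and its covector use matching
   branches of [ff] and [fhat]; in particular [bhat] is never 0. *)
Lemma spacelike_branch y : admissible SpaceLike (g x) ->
  in_sector a b g tt SpaceLike x y ->
  0 < (bf b x y + g x * qf a b x y) / bf b x y.
Proof.
move=> hg yS; have q0 := sector_qf_gt0 yS; have b0 := spacelike_bf_neq0 yS.
have h0 := hf_gt0 hg; have hE := hf_sqr hg; case: yS => _.
move: h0 hE b0 q0; rewrite /gplus /gminus; move: (hf _ _ _) (bf _ _ _) (qf _ _ _ _) (g x).
move=> h c q k h0 /= hE cn0 q0 S.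
have : 0 < (c + k * q) * c.
  case: S => [[c0 qc]|[c0 qc]].
    have cp : 0 < c by rewrite lt_neqAle eq_sym cn0.
    rewrite mulr_gt0//; have [k0|k0] := leP 0 k; first by rewrite ltr_pwDl// mulr_ge0// ltW.
    (* For $k < 0$, the bound $q < (h + k/2)c$ gives $c + kq > c(1 + kh + k^2/2)$; as $h^2 = 1 -
       k^2/4$, the bracket is this sum of squares. *)
    have : 0 <= c * ((h + k / 2) ^+ 2 + k ^+ 2 / 2).
      by rewrite mulr_ge0// addr_ge0 ?sqr_ge0// divr_ge0 ?sqr_ge0.
    have -> : (h + k / 2) ^+ 2 = h ^+ 2 + k * h + k ^+ 2 / 4 by field.
    rewrite hE; nra.
  have cp : c < 0 by rewrite lt_neqAle cn0.
  rewrite nmulr_lgt0//; have [k0|k0] := leP k 0.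
    by rewrite -oppr_gt0 opprD ltr_pwDl ?oppr_gt0// -mulNr mulr_ge0 ?oppr_ge0// ltW.
  (* Mirror image of the previous case under $(c, k) \mapsto (-c, -k)$. *)
  have : 0 <= - c * ((h - k / 2) ^+ 2 + k ^+ 2 / 2).
    by rewrite mulr_ge0 ?oppr_ge0// addr_ge0 ?sqr_ge0// divr_ge0 ?sqr_ge0.
  have -> : (h - k / 2) ^+ 2 = h ^+ 2 - k * h + k ^+ 2 / 4 by field.
  rewrite hE; nra.
move=> cq; have -> : (c + k * q) / c = (c + k * q) * c / c ^+ 2 by field.
by rewrite divr_gt0// exprn_even_gt0.
Qed.

Lemma is_derive_F2 s y v : admissible s (g x) -> in_sector a b g tt s x y ->
  is_derive y v (F2 a b g s x)
    (2 * ((rform a b x y v - (bf b x y + g x * qf a b x y) * bf b x v)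
       * Jf a b g s x y ^+ 2)).
Proof.
move=> hg yS.
(* A directional derivative is the derivative at 0 along the line through [y], which is where the
   one-variable computations apply. *)
suff d : is_derive (0 : R) (1 : R) (fun t => F2 a b g s x (t *: v + y))
   (2 * ((rform a b x y v - (bf b x y + g x * qf a b x y) * bf b x v)
       * Jf a b g s x y ^+ 2)).
  have [d1 d2] := d; split; first exact/derivable1P.
  rewrite -d2 /derive; set k1 := fun h => _; set k2 := fun h => _.
  suff -> : k1 = k2 by [].
  by apply/funext => t; rewrite /k1 /k2 /= addr0 scale0r add0r /GRing.scale /= mulr1.
have q0 := sector_qf_gt0 yS; have S0 := sector_gam yS.
have db := is_derive_bf b x y v.
have dk := is_derive_gam b ha y v.
have y0 : 0 *: v + y = y by rewrite scale0r add0r.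
have dq : is_derive (0 : R) (1 : R) (fun t => qf a b x (t *: v + y))
     (eps R s * rform a b x y v / qf a b x y).
  apply: is_derive_eq (is_derive_sqrt_norm (norm_eps s) dk _) _.
    by rewrite y0.
  by rewrite y0 -/(qf a b x y); field; rewrite lt0r_neq0.
(* Only local: $\gamma = \epsilon q^2$ holds as long as the line stays where $\gamma$ has the sign
   prescribed by the sector. *)
have nk : \forall t \near (0 : R), gam a b x (t *: v + y) =
    eps R s * qf a b x (t *: v + y) ^+ 2.
  have dek := is_deriveZ (eps R s) dk.
  have := near0_is_derive dek; rewrite /GRing.scale /= y0 => /(_ S0).
  by apply: filterS => t /qf_sqr.
have h0 := lt0r_neq0 (hf_gt0 hg); have hE := hf_sqr hg.
case: s hg yS S0 dq nk h0 hE => hg yS S0 dq nk h0 hE.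
- have [u0 v0] := timelike_factors yS.
  rewrite mul1r in hE.
  have := @is_derive_timelike _ _ _ (g x) _ _ _ h0 hE _ _ db dq.
  rewrite /= !y0 => /(_ u0 v0) d.
  apply: near_eq_is_derive (is_derive_eq d _).
  + by near=> t; rewrite /F2 /Bf (near nk t)//= mul1r.
  + congr (2 * ((_ - _) * _)).
    by field; rewrite lt0r_neq0.
- have b0 := spacelike_bf_neq0 yS.
  (* The additive constant of the branch of [ff] in force at [y]. *)
  pose c := (if bf b x y <= 0 then 0 else - pi) - atan (Gf g SpaceLike x / 2).
  rewrite mulN1r in hE.
  have := @is_derive_spacelike _ _ _ (g x) _ c _ _ h0 hE _ db dq.
  rewrite /= !y0 => /(_ b0) d.
  (* As $b \ne 0$ at [y], nearby points of the line use the same branch. *)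
  have nb : \forall t \near (0 : R), (bf b x (t *: v + y) <= 0) = (bf b x y <= 0).
    have [bN|bP] := leP (bf b x y) 0.
      have := near0_is_derive (is_deriveN db).
      rewrite fctE y0 oppr_gt0 lt_neqAle b0 bN => /(_ isT).
      by apply: filterS => t; rewrite oppr_gt0 => /ltW ->.
    have := near0_is_derive db; rewrite y0 => /(_ bP).
    by apply: filterS => t; rewrite leNgt => ->.
  have cE : Jf a b g SpaceLike x y = expR
          (- (2^-1 * (g x / hf g SpaceLike x) *
              (c + atan ((qf a b x y + g x / 2 * bf b x y) / (hf g SpaceLike x * bf b x y))))).
    by rewrite /= /ff /c; case: ifP; rewrite ?add0r.
  apply: near_eq_is_derive (is_derive_eq d _).
  + near=> t; rewrite /F2 /Bf (near nk t)//= mulN1r; congr (_ * _ ^+ 2).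
    by rewrite /ff (near nb t)// /c; case: ifP; rewrite ?add0r.
  + rewrite -cE; congr (2 * ((_ - _) * _)).
    by field; rewrite lt0r_neq0.
Unshelve. all: by end_near. Qed.

End FibreDerivative.

(** * A subtraction formula for the arctangent without branch jump *)

Lemma cos_gt0_lt_pihalf (R : realType) (u : R) :
  `|u| < 3 * (pi / 2) -> 0 < cos u -> `|u| < pi / 2.
Proof.
wlog u0 : u / 0 <= u => [W|].
  have [u0|/ltW u0] := leP 0 u; first exact: W.
  by rewrite -normrN -cosN; apply: W; rewrite oppr_ge0.
rewrite (ger0_norm u0) => u3 cu; rewrite ltNge; apply/negP => pu.
have : 0 <= cos (u - pi) by apply: cos_ge0_pihalf; apply/andP; split; lra.
by rewrite cosB cospi sinpi mulr0 addr0 mulrN1 oppr_ge0 leNgt cu.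
Qed.

(** For $T = \arctan(k/2h)$ one has $\cos T = h$ and $\sin T = k/2$, hence $\cos 2T = 1 - k^2/2$ and
    $\sin 2T = kh$. The tangent subtraction formula is cleared of $\cos 2T$, which may vanish; its
    denominator then has the sign of the cosine of the left-hand side. *)
Lemma atan_subl_double (R : realType) (w k h : R) :
  0 < h -> h ^+ 2 = 1 - k ^+ 2 / 4 ->
  0 < (1 - k ^+ 2 / 2) + w * (k * h) ->
  atan w - 2 * atan (k / h / 2) =
  atan ((w * (1 - k ^+ 2 / 2) - k * h) / ((1 - k ^+ 2 / 2) + w * (k * h))).
Proof.
move=> h0 hE d0; have hn := lt0r_neq0 h0.
set T := atan (k / h / 2); set p := atan w.
have cT : cos T = h.
  rewrite cos_atan (_ : 1 + _ = h ^- 2).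
    by rewrite sqrtrV ?sqr_ge0// sqrtr_sqr invrK gtr0_norm.
  rewrite [k / h / 2](_ : _ = k / 2 / h); last by field.
  rewrite expr_div_n -[X in X + _](mulfV (expf_neq0 2 hn)) -mulrDl.
  by rewrite (_ : h ^+ 2 + _ = 1) ?mul1r// hE; field.
have sT : sin T = k / 2.
  have := atanK (k / h / 2); rewrite -/T /tan cT => /(congr1 ( *%R^~ h)).
  by rewrite divfK// => ->; field.
have cp : 0 < cos p by apply: cos_gt0_pihalf; rewrite atan_gtNpi2 atan_ltpi2.
have sp : sin p = w * cos p.
  by have := atanK w; rewrite -/p /tan => <-; rewrite divfK// lt0r_neq0.
have c2 : cos (2 * T) = 1 - k ^+ 2 / 2.
  rewrite (_ : 2 * T = T + T); last by ring.
  by rewrite cosD cT sT -!expr2 hE; field.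
have s2 : sin (2 * T) = k * h.
  rewrite (_ : 2 * T = T + T); last by ring.
  by rewrite sinD cT sT; field.
have cE : cos (p - 2 * T) = cos p * ((1 - k ^+ 2 / 2) + w * (k * h)).
  by rewrite cosB c2 s2 sp; ring.
have sE : sin (p - 2 * T) = cos p * (w * (1 - k ^+ 2 / 2) - k * h).
  by rewrite sinB c2 s2 sp; ring.
(* A priori the angle is only below $3\pi/2$ in absolute value; the positive cosine brings it into
   the range of [atan]. *)
have : `|p - 2 * T| < pi / 2.
  apply: cos_gt0_lt_pihalf; last by rewrite cE mulr_gt0.
  have := atan_gtNpi2 w; have := atan_ltpi2 w.
  have := atan_gtNpi2 (k / h / 2); have := atan_ltpi2 (k / h / 2).
  by rewrite -/T -/p ltr_norml => *; apply/andP; split; lra.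
rewrite ltr_norml => pB; rewrite -[LHS]tanK ?in_itv//; congr atan.
by rewrite /tan cE sE -mulf_div mulfV ?mul1r// lt0r_neq0.
Qed.

(** * The covector of a vector in either sector *)

Section Covector.
Variables (R : realType) (N : nat) (M : Type).
Variables (a : M -> 'M[R]_N) (b : M -> 'rV[R]_N) (g : M -> R) (tt : M -> 'rV[R]_N).
Variable (x : M).
Hypothesis ha : lorentzian (a x).
Hypothesis hb : b_normsq a b x = -1.
Variables (s : sector) (y : 'rV[R]_N).
Hypothesis hg : admissible s (g x).
Hypothesis yS : in_sector a b g tt s x y.
Let p := yhat a b g s x y.
Let J := Jf a b g s x y.

Lemma yhatE :
  p = J ^+ 2 *: ((- (bf b x y + g x * qf a b x y)) *: b x + y *m rmx a b x).
Proof.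
apply/rowP => i; rewrite mxE.
have [_ ->] := is_derive_F2 ha (delta_mx 0 i) hg yS.
rewrite mulKf ?pnatr_eq0// -/J /rform.
have dE (z : 'rV[R]_N) : (z *m (delta_mx 0 i : 'rV[R]_N)^T) 0 0 = z 0 i.
  by rewrite trmx_delta -colE mxE.
have -> : bf b x (delta_mx 0 i) = b x 0 i.
  by rewrite bfE -rowE !mxE.
rewrite dE !mxE; ring.
Qed.

Lemma bhat_yhat : bhat a b x p = (bf b x y + g x * qf a b x y) * J ^+ 2.
Proof. by rewrite yhatE bhat_covector// mulrN opprK mulrC. Qed.

Lemma qhat_yhat : qhat a b x p = qf a b x y * J ^+ 2.
Proof. by rewrite yhatE qhat_covector// ger0_norm// sqr_ge0. Qed.

Lemma Bhat_yhat : Bhat a b g s x p = Bf a b g x y * J ^+ 4.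
Proof.
rewrite /Bhat bhat_yhat qhat_yhat /Bf (qf_sqr (sector_gam yS)); ring.
Qed.

Lemma Jf_gt0 : 0 < J.
Proof.
rewrite /J; case: s hg yS => hg' yS' /=; last exact: expR_gt0.
have [u0 v0] := timelike_factors yS'.
by rewrite powR_gt0// divr_gt0.
Qed.

End Covector.

(** * The Hamiltonian in the time-like sector *)

Section FibreTimelike.
Variables (R : realType) (N : nat) (M : Type).
Variables (a : M -> 'M[R]_N) (b : M -> 'rV[R]_N) (g : M -> R) (tt : M -> 'rV[R]_N).
Variable (x : M).
Hypothesis ha : lorentzian (a x).
Hypothesis hb : b_normsq a b x = -1.
Variable (y : 'rV[R]_N).
Let s := FutureTimeLike.
Hypothesis yS : in_sector a b g tt s x y.
Let p := yhat a b g s x y.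
Let J := Jf a b g s x y.
Let u := bf b x y - gminus g s x * qf a b x y.
Let v := gplus g s x * qf a b x y - bf b x y.

(** The term $gq$ in $\hat b$ exchanges the two roots: $g + g_+ = -g_-$. The second factor likewise
    uses $-g_- - g = g_+$. *)
Lemma timelike_factor1 : bhat a b x p + gplus g s x * qhat a b x p = J ^+ 2 * u.
Proof.
rewrite /p (bhat_yhat ha hb (I : admissible s (g x)) yS).
rewrite (qhat_yhat ha hb (I : admissible s (g x)) yS) -/J /u /gplus /gminus; field.
by [].
Qed.

Lemma timelike_factor2 : - gminus g s x * qhat a b x p - bhat a b x p = J ^+ 2 * v.
Proof.
rewrite /p (bhat_yhat ha hb (I : admissible s (g x)) yS).
rewrite (qhat_yhat ha hb (I : admissible s (g x)) yS) -/J /v /gplus /gminus; field.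
by [].
Qed.

Lemma timelike_Jhat : Jhat a b g s x p = 1 / J.
Proof.
have [u0 v0] := timelike_factors yS.
have J2 : J ^+ 2 != 0 by rewrite expf_neq0// lt0r_neq0// (Jf_gt0 (I : admissible s (g x)) yS).
rewrite /Jhat /= -/s timelike_factor1 timelike_factor2 -mulf_div mulfV// mul1r.
by rewrite /J /Jf powRN div1r invrK.
Qed.

Lemma timelike_Bhat : Bhat a b g s x p =
  (bhat a b x p + gplus g s x * qhat a b x p) *
  (- gminus g s x * qhat a b x p - bhat a b x p).
Proof.
have := gplus_gminus g x; rewrite /Bhat -/s => gpm.
move: (qhat _ _ _ _) (bhat _ _ _ _) => q c.
(* The coefficient 1 of $\hat q^2$ is rewritten as $-g_+g_-$. *)
transitivity (- (gplus g s x * gminus g s x) * q ^+ 2 + g x * c * q - c ^+ 2).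
  by rewrite gpm opprK.
by rewrite /gplus /gminus /s; field.
Qed.

(** The right-hand side is $UV(U/V)^{G/2}$ in the two factors, and the exponents agree because $1 +
    G/2 = -G_-$ and $1 - G/2 = G_+$. *)
Lemma timelike_hamiltonian :
  (bhat a b x p + gplus g s x * qhat a b x p) `^ (- Gminus g s x) *
  (- gminus g s x * qhat a b x p - bhat a b x p) `^ (Gplus g s x) =
  Bhat a b g s x p * Jhat a b g s x p ^+ 2.
Proof.
have [u0 v0] := timelike_factors yS; have J0 := Jf_gt0 (I : admissible s (g x)) yS.
have h0 := lt0r_neq0 (@hf_gt0 R M g x s I).
rewrite timelike_Bhat /Jhat /= -/s timelike_factor1 timelike_factor2.
have U0 : 0 < J ^+ 2 * u by rewrite mulr_gt0// exprn_gt0.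
have V0 : 0 < J ^+ 2 * v by rewrite mulr_gt0// exprn_gt0.
move: (J ^+ 2 * u) (J ^+ 2 * v) U0 V0 => U V U0 V0.
rewrite -(lnK (x := U)) ?posrE// -(lnK (x := V)) ?posrE// -expRB -!expRM -expRM_natl -!expRD.
congr expR; rewrite /Gplus /Gminus /Gf /gplus /gminus -/s.
by field.
Qed.

End FibreTimelike.

(** * The space-like angle, and the conclusion for both sectors *)

Lemma spacelike_fhat (R : realType) (N : nat) (M : Type) (a : M -> 'M[R]_N)
    (b : M -> 'rV[R]_N) (g : M -> R) (t : M -> 'rV[R]_N) (x : M) (y : 'rV[R]_N) :
  lorentzian (a x) -> b_normsq a b x = -1 -> admissible SpaceLike (g x) ->
  in_sector a b g t SpaceLike x y ->
  fhat a b g SpaceLike x (yhat a b g SpaceLike x y) = ff a b g SpaceLike x y.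
Proof.
move=> ha hb hg yS; rewrite /fhat /ff.
rewrite (bhat_yhat ha hb hg yS) (qhat_yhat ha hb hg yS).
have J0 := Jf_gt0 hg yS; have b0 := spacelike_bf_neq0 yS.
have br := spacelike_branch hg yS.
have h0 := hf_gt0 hg; have hE := hf_sqr hg.
rewrite mulN1r in hE; have hn := lt0r_neq0 h0; rewrite /Gf.
move: (Jf _ _ _ _ _ _) (bf _ _ _) (qf _ _ _ _) (hf _ _ _) (g x) J0 b0 br h0 hE hn.
move=> J c q h k J0 c0 br h0 hE hn.
have J2 : 0 < J ^+ 2 by rewrite exprn_gt0.
have e0 : c + k * q != 0 by apply: contraTneq br => ->; rewrite mul0r ltxx.
(* The denominator required to be positive in [atan_subl_double] is exactly the ratio controlled by
   [spacelike_branch]. *)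
have dE : (1 - k ^+ 2 / 2) + (q + k / 2 * c) / (h * c) * (k * h) = (c + k * q) / c.
  by field; rewrite hn c0.
have := @atan_subl_double _ ((q + k / 2 * c) / (h * c)) _ _ h0 hE.
rewrite dE => /(_ br).
have -> : ((q + k / 2 * c) / (h * c) * (1 - k ^+ 2 / 2) - k * h) / ((c + k * q) / c) =
    (q * J ^+ 2 - k / 2 * ((c + k * q) * J ^+ 2)) / (h * ((c + k * q) * J ^+ 2)).
  (* This makes $h$ appear squared, so that $h^2 = 1 - k^2/4$ can be substituted. *)
  have -> : k * h = k * h ^+ 2 / h by field.
  rewrite hE; field.
  by rewrite hn c0 e0 lt0r_neq0.
rewrite pmulr_lge0//.
have -> : (0 <= c + k * q) = ~~ (c <= 0).
  rewrite -ltNge; case: (ltP 0 c) => [cp|cn].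
    by rewrite -[c + _](divfK c0) pmulr_lge0// ltW.
  have cn' : c < 0 by rewrite lt_neqAle c0.
  by rewrite -[c + _](divfK c0) pmulr_rge0// leNgt cn'.
(* With $T = \arctan(G/2)$, both branches reduce to $\arctan w - T = T + (\arctan w - 2T)$; the
   $\pm\pi$ match. *)
by case: (c <= 0) => <- /=; ring.
Qed.

Lemma Jhat_yhat (R : realType) (N : nat) (M : Type) (a : M -> 'M[R]_N)
    (b : M -> 'rV[R]_N) (g : M -> R) (t : M -> 'rV[R]_N) (x : M) (s : sector)
    (y : 'rV[R]_N) :
  lorentzian (a x) -> b_normsq a b x = -1 -> admissible s (g x) ->
  in_sector a b g t s x y ->
  Jhat a b g s x (yhat a b g s x y) = 1 / Jf a b g s x y.
Proof.
case: s => ha hb hg yS; first exact: timelike_Jhat yS.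
by rewrite /= (spacelike_fhat ha hb hg yS) expRN div1r invrK.
Qed.

Lemma F2_yhat (R : realType) (N : nat) (M : Type) (a : M -> 'M[R]_N)
    (b : M -> 'rV[R]_N) (g : M -> R) (t : M -> 'rV[R]_N) (x : M) (s : sector)
    (y : 'rV[R]_N) (p := yhat a b g s x y) :
  lorentzian (a x) -> b_normsq a b x = -1 -> admissible s (g x) ->
  in_sector a b g t s x y ->
  F2 a b g s x y = Bhat a b g s x p * Jhat a b g s x p ^+ 2.
Proof.
move=> ha hb hg yS; have J0 := lt0r_neq0 (Jf_gt0 hg yS).
by rewrite (Bhat_yhat ha hb hg yS) (Jhat_yhat ha hb hg yS) /F2; field.
Qed.

Theorem mainTheorem7 (R : realType) (N : nat) (M : Type)
    (a : M -> 'M[R]_N) (b : M -> 'rV[R]_N) (g : M -> R) (t : M -> 'rV[R]_N)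
    (s : sector)
    (ha : forall x, lorentzian (a x))
    (hb : forall x, b_normsq a b x = -1)
    (ht : forall x, 0 < metric_form a x (t x) (t x))
    (hg : forall x, admissible s (g x)) :
  (forall x y, in_sector a b g t s x y ->
     let p := yhat a b g s x y in
     let J := Jf a b g s x y in
     [/\ forall i, derivable (F2 a b g s x) y (delta_mx 0 i),
         bhat a b x p = (bf b x y + g x * qf a b x y) * J ^+ 2,
         qhat a b x p = qf a b x y * J ^+ 2 &
         Bhat a b g s x p = Bf a b g x y * J ^+ 4]) /\
  (exists H2, squared_hamiltonian a b g t s H2) /\
  (forall H2, squared_hamiltonian a b g t s H2 ->
   forall x y, in_sector a b g t s x y ->
     let p := yhat a b g s x y in
     [/\ H2 x p = Bhat a b g s x p * Jhat a b g s x p ^+ 2,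
         Jhat a b g s x p = 1 / Jf a b g s x y &
         s = FutureTimeLike ->
           H2 x p =
             (bhat a b x p + gplus g s x * qhat a b x p)
               `^ (- Gminus g s x) *
             (- gminus g s x * qhat a b x p - bhat a b x p)
               `^ (Gplus g s x) /\
           Bhat a b g s x p =
             (bhat a b x p + gplus g s x * qhat a b x p) *
             (- gminus g s x * qhat a b x p - bhat a b x p)]).
Proof.
split=> [x y yS p J|]; last split=> [|H2 HH x y yS p].
- split=> [i|||].
  + by have [] := is_derive_F2 (ha x) (delta_mx 0 i) (hg x) yS.
  + exact: bhat_yhat yS.
  + exact: qhat_yhat yS.
  + exact: Bhat_yhat yS.
(* The witness is a closed formula in the covector, so $F^2$ takes equal values at vectors of the
   sector that share a covector. *)
- exists (fun x p => Bhat a b g s x p * Jhat a b g s x p ^+ 2) => x y yS.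
  exact/esym/(F2_yhat (ha x) (hb x) (hg x) yS).
have HE : H2 x p = Bhat a b g s x p * Jhat a b g s x p ^+ 2.
  by rewrite HH// (F2_yhat (ha x) (hb x) (hg x) yS).
split=> // [|sE]; first exact: Jhat_yhat yS.
rewrite HE; move: yS @p {HE HH hg}; rewrite sE => yS p; split.
  by rewrite (timelike_hamiltonian (ha x) (hb x) yS).
exact: timelike_Bhat.
Qed.
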